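(* For each $\varepsilon>0$ there exists an increasing sequence of positive integers $\mathcal{N}=(n_j)_{j\ge1}$ whose counting function satisfies $N(x)=x+O(x^{1/2+\varepsilon})$ and for which $\mathrm{LH}(\mathcal{N},x)$ fails.
   Context: $N(x)=\#\{j:n_j\le x\}$. For a differentiable $M$, $\mathrm{LH}(\mathcal{N},M(x))$ means: for every $\varepsilon'>0$ and $B>0$ there is $C=C(\varepsilon',B)$ with $\bigl|\sum_{n_j\le x}n_j^{-\mathrm{i} t}-\int_{n_1}^x u^{-\mathrm{i} t}M'(u)\,\mathrm{d}u\bigr|\le C M(x)^{1/2}|t|^{\varepsilon'}$ for all real $t$ and $n_1\le x\le|t|^B$. Here $M(x)=x$. *)

(* Defs.v *)
From Stdlib Require Import Reals Lra Lia List ZArith.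
From Coquelicot Require Import Coquelicot.
Open Scope R_scope.

(* Sequences are indexed from 0, so [n 0%nat] is the first term n_1. *)
Definition increasing_pos (n : nat -> nat) : Prop :=
  (0 < n 0)%nat /\ (forall j, (n j < n (S j))%nat).

(* The indices j with n_j <= x.  The search is cut off at j < up x, which loses
   nothing for an increasing sequence since then j < n_j; see [In_indices]. *)
Definition indices (n : nat -> nat) (x : R) : list nat :=
  filter (fun j => if Rle_dec (INR (n j)) x then true else false)
         (seq 0 (Z.to_nat (up x))).

Lemma NoDup_indices (n : nat -> nat) (x : R) : NoDup (indices n x).
Proof. apply NoDup_filter, seq_NoDup. Qed.

Lemma increasing_pos_gt (n : nat -> nat) :
  increasing_pos n -> forall j, (j < n j)%nat.
Proof.
  intros [H0 HS] j; induction j as [|j IH]; [exact H0|].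
  specialize (HS j); lia.
Qed.

Lemma In_indices (n : nat -> nat) (x : R) (j : nat) :
  increasing_pos n -> (In j (indices n x) <-> INR (n j) <= x).
Proof.
  intros Hn; unfold indices; rewrite filter_In, in_seq.
  destruct (Rle_dec (INR (n j)) x) as [Hx|Hx]; split; intros H;
    try (destruct H; discriminate); try easy.
  split; [|reflexivity].
  pose proof (lt_INR _ _ (increasing_pos_gt n Hn j)) as Hj.
  destruct (archimed x) as [Hup _].
  assert (Hz : IZR (Z.of_nat j) < IZR (up x)) by (rewrite <- INR_IZR_INZ; lra).
  apply lt_IZR in Hz; lia.
Qed.

Definition counting (n : nat -> nat) (x : R) : R := INR (length (indices n x)).

(* u^(-it) = exp (-it ln u) for u > 0 *)
Definition pow_mit (t u : R) : C := (cos (t * ln u), - sin (t * ln u)).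

(* [Rpower 0 y] is 1; here 0^y = 0, as it should be for y > 0. *)
Definition rpow (x y : R) : R := if Rlt_dec 0 x then Rpower x y else 0.

Definition exp_sum (n : nat -> nat) (t x : R) : C :=
  fold_right Cplus (RtoC 0) (map (fun j => pow_mit t (INR (n j))) (indices n x)).

Definition exp_int (M : R -> R) (t a x : R) : C :=
  @RInt C_R_CompleteNormedModule
    (fun u => Cmult (pow_mit t u) (RtoC (Derive M u))) a x.

Definition LH (n : nat -> nat) (M : R -> R) : Prop :=
  forall eps' B : R, 0 < eps' -> 0 < B ->
  exists K : R, forall t x : R,
    INR (n 0%nat) <= x <= rpow (Rabs t) B ->
    Cmod (Cminus (exp_sum n t x) (exp_int M t (INR (n 0%nat)) x))
      <= K * sqrt (M x) * rpow (Rabs t) eps'.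

(* Main.v *)
Require Import Defs.
From Stdlib Require Import Reals.
From Coquelicot Require Import Coquelicot.
From Stdlib Require Import Lra Lia List ZArith.
Open Scope R_scope.

(** The sequence runs through the integers but leaves, near each power [P] of 2,
    a gap of length [L] comparable to [P^(1/2+e)], where [e = min eps (1/4)];
    since the gap lengths grow geometrically, the counting function is
    [x + O(x^(1/2+e))].  Across such a gap the exponential sum does not change,
    whereas for [t = P^(1/2-e)] the phase [t ln u] moves by at most 1, so that
    the integral of [u^(-it)] changes by at least [L / 2].  This exceeds
    [P^(1/2) t^e] by a factor [P^(e(1/2+e))], up to a constant. *)

(** * Increasing sequences and their index lists *)

Lemma increasing_pos_mono (n : nat -> nat) :
  increasing_pos n -> forall i j, (i <= j)%nat -> (n i <= n j)%nat.
Proof.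
  intros [_ HS] i j Hij; induction Hij as [|j _ IH]; [lia|].
  specialize (HS j); lia.
Qed.

(** The cutoff [up x] does not truncate the initial segment: its last index lies in [indices n x],
    hence below the cutoff. The filter then keeps the first [J] indices and drops the rest. *)
Lemma indices_eq_seq (n : nat -> nat) (x : R) (J : nat) :
  increasing_pos n -> (forall j, INR (n j) <= x <-> (j < J)%nat) ->
  indices n x = seq 0 J.
Proof.
  intros Hn HJ.
  assert (HJx : (J <= Z.to_nat (up x))%nat).
  { destruct J as [|J]; [lia|].
    assert (Hin : In J (indices n x)) by (apply In_indices, HJ; [easy|lia]).
    apply filter_In in Hin; destruct Hin as [Hin _].
    apply in_seq in Hin; lia. }
  unfold indices.
  replace (Z.to_nat (up x)) with (J + (Z.to_nat (up x) - J))%nat by lia.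
  rewrite seq_app, filter_app.
  rewrite (filter_ext_in _ (fun _ => true) (seq 0 J)), filter_true.
  - rewrite (filter_ext_in _ (fun _ => false)), filter_false, app_nil_r;
      [reflexivity|].
    intros j Hj; apply in_seq in Hj.
    destruct (Rle_dec (INR (n j)) x) as [Hx|Hx]; [|reflexivity].
    apply HJ in Hx; lia.
  - intros j Hj; apply in_seq in Hj.
    destruct (Rle_dec (INR (n j)) x) as [Hx|Hx]; [reflexivity|].
    exfalso; apply Hx, HJ; lia.
Qed.

Lemma indices_between (n : nat -> nat) (x : R) (j : nat) :
  increasing_pos n -> INR (n j) <= x < INR (n (S j)) ->
  indices n x = seq 0 (S j).
Proof.
  intros Hn Hx; apply indices_eq_seq; [exact Hn|]; intros i; split; intros Hi.
  - destruct (le_lt_dec (S j) i) as [Hij|Hij]; [|exact Hij].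
    apply (increasing_pos_mono n Hn), le_INR in Hij; lra.
  - assert (Hij : (i <= j)%nat) by lia.
    apply (increasing_pos_mono n Hn), le_INR in Hij; lra.
Qed.

(** Since [m < n m], some term exceeds [x]; descending from it leads to the last term that is at
    most [x]. *)
Lemma exists_between (n : nat -> nat) (x : R) :
  increasing_pos n -> INR (n 0%nat) <= x ->
  exists j, INR (n j) <= x < INR (n (S j)).
Proof.
  intros Hn H0.
  assert (Hm : exists m, x < INR (n m)).
  { exists (Z.to_nat (up x)).
    pose proof (lt_INR _ _ (increasing_pos_gt n Hn (Z.to_nat (up x)))) as Hu.
    destruct (archimed x) as [Hup _].
    pose proof (pos_INR (n 0%nat)) as Hpos.
    assert (0 <= up x)%Z by (apply le_IZR; lra).
    rewrite INR_IZR_INZ, Z2Nat.id in Hu by assumption; lra. }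
  destruct Hm as [m Hm]; induction m as [|m IH]; [lra|].
  destruct (Rlt_dec x (INR (n m))) as [Hx|Hx]; [auto|].
  exists m; lra.
Qed.

(** * The integral of u^(-it) over an interval of small phase change *)

Lemma continuous_cos_ln (t u : R) : 0 < u ->
  continuous (fun u => cos (t * ln u)) u.
Proof.
  intros Hu; apply (ex_derive_continuous (K := R_AbsRing) (V := R_NormedModule)).
  auto_derive; exact Hu.
Qed.

Lemma continuous_sin_ln (t u : R) : 0 < u ->
  continuous (fun u => - sin (t * ln u)) u.
Proof.
  intros Hu; apply (ex_derive_continuous (K := R_AbsRing) (V := R_NormedModule)).
  auto_derive; exact Hu.
Qed.

Lemma ex_RInt_continuous_pos (f : R -> R) (a b : R) :
  (forall u, 0 < u -> continuous f u) -> 0 < a -> 0 < b -> ex_RInt f a b.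
Proof.
  intros Hf Ha Hb.
  apply (ex_RInt_continuous (V := R_CompleteNormedModule)); intros u Hu.
  apply Hf; pose proof (Rmin_glb_lt a b 0 Ha Hb); lra.
Qed.

Lemma exp_int_id (t a b : R) : 0 < a -> 0 < b ->
  exp_int (fun x => x) t a b =
  (RInt (fun u => cos (t * ln u)) a b, RInt (fun u => - sin (t * ln u)) a b).
Proof.
  intros Ha Hb; unfold exp_int.
  apply (is_RInt_unique (V := C_R_CompleteNormedModule)).
  apply (is_RInt_ext (V := C_R_NormedModule) (pow_mit t)).
  - intros u _; rewrite Derive_id; symmetry; apply Cmult_1_r.
  - apply (is_RInt_fct_extend_pair (U := R_NormedModule) (V := R_NormedModule));
      apply (RInt_correct (V := R_CompleteNormedModule));
      apply ex_RInt_continuous_pos; auto using continuous_cos_ln, continuous_sin_ln.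
Qed.

(** The left side is the real part of (x + iy) e^(i th). *)
Lemma Cmod_ge_rotation (x y th : R) : x * cos th - y * sin th <= Cmod (x, y).
Proof.
  unfold Cmod; simpl fst; simpl snd.
  apply Rle_trans with (1 := Rle_abs _); rewrite <- sqrt_Rsqr_abs.
  apply sqrt_le_1_alt; unfold Rsqr.
  pose proof (sin2_cos2 th) as H; unfold Rsqr in H.
  pose proof (Rle_0_sqr (x * sin th + y * cos th)) as H1; unfold Rsqr in H1.
  nra.
Qed.

Lemma cos_ge_half (d : R) : 0 <= d <= 1 -> 1 / 2 <= cos d.
Proof.
  intros Hd; pose proof PI2_3_2 as HPI; rewrite <- cos_PI3.
  apply cos_decr_1; lra.
Qed.

Lemma ln_sub_le (a u : R) : 0 < a <= u -> 0 <= ln u - ln a <= (u - a) / a.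
Proof.
  intros [Ha Hu]; split.
  - pose proof (ln_le a u Ha Hu); lra.
  - rewrite <- ln_div by lra.
    assert (Hq : 0 < u / a) by (apply Rdiv_lt_0_compat; lra).
    pose proof (exp_ineq1_le (ln (u / a))) as H.
    rewrite exp_ln in H by exact Hq.
    replace ((u - a) / a) with (u / a - 1) by (field; lra); lra.
Qed.

Lemma Cminus_add_pair (x y x' y' : R) :
  Cminus (x + x', y + y') (x, y) = (x', y').
Proof. unfold Cminus, Cplus, Copp; simpl; f_equal; ring. Qed.

(** Rotation by e^(it ln a) turns the integrand on [a, b] into e^(-it (ln u - ln a)). Its phase is
    at most t (b - a) / a <= 1 in size, so its real part is at least cos 1 >= 1/2. *)
Lemma exp_int_increment_ge (t c a b : R) :
  0 < c -> 0 < a <= b -> 0 <= t -> t * (b - a) <= a ->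
  (b - a) / 2 <=
  Cmod (Cminus (exp_int (fun x => x) t c b) (exp_int (fun x => x) t c a)).
Proof.
  intros Hc [Ha Hab] Ht Hphase.
  assert (Hb : 0 < b) by lra.
  rewrite !exp_int_id by assumption.
  pose proof (ex_RInt_continuous_pos _ c a (continuous_cos_ln t) Hc Ha) as C1.
  pose proof (ex_RInt_continuous_pos _ a b (continuous_cos_ln t) Ha Hb) as C2.
  pose proof (ex_RInt_continuous_pos _ c a (continuous_sin_ln t) Hc Ha) as S1.
  pose proof (ex_RInt_continuous_pos _ a b (continuous_sin_ln t) Ha Hb) as S2.
  set (I := RInt (fun u => cos (t * ln u)) a b).
  set (J := RInt (fun u => cos (t * ln u)) c a).
  set (I' := RInt (fun u => - sin (t * ln u)) a b).
  set (J' := RInt (fun u => - sin (t * ln u)) c a).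
  replace (RInt (fun u => cos (t * ln u)) c b) with (J + I)
    by apply (RInt_Chasles (V := R_CompleteNormedModule) _ _ _ _ C1 C2).
  replace (RInt (fun u => - sin (t * ln u)) c b) with (J' + I')
    by apply (RInt_Chasles (V := R_CompleteNormedModule) _ _ _ _ S1 S2).
  apply (RInt_correct (V := R_CompleteNormedModule)) in C2, S2.
  fold I in C2; fold I' in S2.
  rewrite Cminus_add_pair.
  apply Rle_trans with (2 := Cmod_ge_rotation I I' (t * ln a)).
  pose proof (is_RInt_plus (V := R_NormedModule) _ _ _ _ _ _
    (is_RInt_scal (V := R_NormedModule) _ _ _ (cos (t * ln a)) _ C2)
    (is_RInt_scal (V := R_NormedModule) _ _ _ (- sin (t * ln a)) _ S2)) as H.
  pose proof (is_RInt_const (V := R_NormedModule) a b (1 / 2)) as H2.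
  pose proof (is_RInt_le _ _ _ _ _ _ Hab H2 H) as Hle.
  unfold scal, plus, mult in Hle; simpl in Hle; unfold mult in Hle; simpl in Hle.
  cut ((b - a) * (1 / 2) <= cos (t * ln a) * I + - sin (t * ln a) * I'); [lra|].
  apply Hle; intros u Hu.
  replace (_ + _) with (cos (t * ln u - t * ln a)) by (rewrite cos_minus; ring).
  apply cos_ge_half.
  destruct (ln_sub_le a u) as [H3 H4]; [lra|].
  rewrite <- Rmult_minus_distr_l; split; [nra|].
  apply Rle_trans with (t * ((b - a) / a)).
  - apply Rmult_le_compat_l; [exact Ht|]; apply Rle_trans with (1 := H4).
    apply Rmult_le_compat_r; [apply Rlt_le, Rinv_0_lt_compat, Ha|lra].
  - unfold Rdiv; rewrite <- Rmult_assoc; apply Rle_div_l; lra.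
Qed.

(** * The gapped sequence and its counting function *)

Lemma Rpower_2_nat (k : nat) : Rpower 2 (INR k) = INR (2 ^ k).
Proof. rewrite Rpower_pow, pow_INR; [reflexivity|lra]. Qed.

(** The number of positive integers left out before the term of index [j]. It is constant on dyadic
    blocks of indices, so gaps open only where [j] reaches a power of 2. As [Nat.log2 0 = 0], one
    integer is left out at the start and the first term is 2. *)
Definition skipped (a : R) (j : nat) : nat :=
  Z.to_nat (Int_part (Rpower 2 (INR (Nat.log2 j) * a))).

Definition gapped (a : R) (j : nat) : nat := S (j + skipped a j).

Lemma skipped_bounds (a : R) (j : nat) :
  Rpower 2 (INR (Nat.log2 j) * a) - 1 < INR (skipped a j)
    <= Rpower 2 (INR (Nat.log2 j) * a).
Proof.
  unfold skipped; set (r := Rpower 2 _).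
  assert (Hr : 0 < r) by apply exp_pos.
  destruct (base_Int_part r) as [H1 H2].
  assert (0 <= Int_part r)%Z.
  { assert (-1 < Int_part r)%Z by (apply lt_IZR; lra); lia. }
  rewrite INR_IZR_INZ, Z2Nat.id by assumption; lra.
Qed.

Lemma skipped_mono (a : R) (i j : nat) :
  0 <= a -> (i <= j)%nat -> (skipped a i <= skipped a j)%nat.
Proof.
  intros Ha Hij; apply Nat.lt_succ_r, INR_lt; rewrite S_INR.
  destruct (skipped_bounds a i) as [_ Hi]; destruct (skipped_bounds a j) as [Hj _].
  apply Nat.log2_le_mono, le_INR in Hij.
  assert (Rpower 2 (INR (Nat.log2 i) * a) <= Rpower 2 (INR (Nat.log2 j) * a)).
  { apply Rle_Rpower; [lra|]; apply Rmult_le_compat_r; lra. }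
  lra.
Qed.

Lemma skipped_le_Rpower (a : R) (j : nat) :
  0 <= a -> (0 < j)%nat -> INR (skipped a j) <= Rpower (INR j) a.
Proof.
  intros Ha Hj; destruct (skipped_bounds a j) as [_ H].
  apply Rle_trans with (1 := H); rewrite <- Rpower_mult, Rpower_2_nat.
  destruct (Nat.log2_spec j Hj) as [Hl _].
  apply Rle_Rpower_l; [exact Ha|]; split; [|apply le_INR, Hl].
  rewrite <- Rpower_2_nat; apply exp_pos.
Qed.

Lemma gapped_increasing (a : R) : 0 <= a -> increasing_pos (gapped a).
Proof.
  intros Ha; unfold gapped; split; [lia|]; intros j.
  pose proof (skipped_mono a j (S j) Ha); lia.
Qed.

Lemma INR_gapped (a : R) (j : nat) :
  INR (gapped a j) = INR j + 1 + INR (skipped a j).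
Proof. unfold gapped; rewrite S_INR, plus_INR; ring. Qed.

(** If [x] lies between the terms of indices [j] and [S j], the count is j + 1, and x - (j + 1) lies
    between 0 and 1 + (j + 1)^a, which is at most 2 x^a. *)
Lemma counting_gapped (a x : R) : 0 <= a -> INR (gapped a 0) <= x ->
  Rabs (counting (gapped a) x - x) <= 2 * Rpower x a.
Proof.
  intros Ha Hx0; pose proof (gapped_increasing a Ha) as Hn.
  destruct (exists_between _ _ Hn Hx0) as [j Hj]; unfold counting.
  rewrite (indices_between _ _ _ Hn Hj), length_seq.
  rewrite !INR_gapped in Hj.
  pose proof (skipped_le_Rpower a (S j) Ha ltac:(lia)) as H1.
  pose proof (pos_INR (skipped a j)) as H2; pose proof (pos_INR j) as H3.
  rewrite S_INR in *.
  assert (H4 : Rpower (INR j + 1) a <= Rpower x a) by (apply Rle_Rpower_l; lra).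
  assert (H5 : 1 <= Rpower x a).
  { rewrite <- (Rpower_O x) by lra; apply Rle_Rpower; lra. }
  apply Rabs_le; lra.
Qed.

(** * Failure of the hypothesis across the gaps *)

(** The hypothesis is applied at both ends of a stretch free of new terms. The two sums agree, so
    the increment of the integral is bounded by the two errors together. *)
Lemma LH_gap (n : nat -> nat) (e B : R) :
  increasing_pos n -> LH n (fun x => x) -> 0 < e -> 0 < B ->
  exists K, forall (j : nat) (t x : R),
    INR (n j) <= x < INR (n (S j)) -> 0 <= t -> t * (x - INR (n j)) <= INR (n j) ->
    x <= rpow t B -> (x - INR (n j)) / 2 <= K * sqrt x * rpow t e.
Proof.
  intros Hn HLH He HB; destruct (HLH e B He HB) as [K HK].
  exists (2 * Rabs K); intros j t x Hx Ht Hphase HxB.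
  assert (Hr : 0 <= rpow t e).
  { unfold rpow; destruct (Rlt_dec 0 t); [apply Rlt_le, exp_pos|lra]. }
  destruct Hn as [Hn0 HnS]; pose proof (conj Hn0 HnS : increasing_pos n) as Hn.
  pose proof (le_INR _ _ (increasing_pos_mono n Hn 0 j ltac:(lia))) as H0j.
  pose proof (lt_INR _ _ Hn0) as H0; simpl in H0.
  pose proof (HK t x) as H2; pose proof (HK t (INR (n j))) as H1.
  rewrite (Rabs_pos_eq t Ht) in H1, H2.
  specialize (H1 ltac:(lra)); specialize (H2 ltac:(lra)).
  unfold exp_sum in H1, H2.
  rewrite (indices_between n x j Hn Hx) in H2.
  rewrite (indices_between n (INR (n j)) j Hn) in H1 by lra.
  set (s := fold_right _ _ _) in H1, H2.
  pose proof (exp_int_increment_ge t (INR (n 0%nat)) (INR (n j)) x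
    H0 ltac:(lra) Ht Hphase) as HI.
  set (I1 := exp_int _ _ _ (INR (n j))) in H1, HI.
  set (I2 := exp_int _ _ _ x) in H2, HI.
  replace (Cminus I2 I1) with (Cplus (Cminus s I1) (Copp (Cminus s I2))) in HI
    by ring.
  pose proof (Cmod_triangle (Cminus s I1) (Copp (Cminus s I2))) as HT.
  rewrite Cmod_opp in HT.
  (* The sign of [K] is unknown; [Rabs K] makes the bound monotone in the endpoint. *)
  assert (Hs : forall y, 0 <= y <= x ->
    K * sqrt y * rpow t e <= Rabs K * sqrt x * rpow t e).
  { intros y Hy; apply Rmult_le_compat_r; [exact Hr|].
    apply Rle_trans with (Rabs K * sqrt y).
    - apply Rmult_le_compat_r; [apply sqrt_pos|apply Rle_abs].
    - apply Rmult_le_compat_l; [apply Rabs_pos|apply sqrt_le_1_alt; lra]. }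
  pose proof (Hs x ltac:(lra)); pose proof (Hs (INR (n j)) ltac:(lra)); lra.
Qed.

Lemma not_LH_gapped (e : R) : 0 < e <= 1 / 4 ->
  ~ LH (gapped (1 / 2 + e)) (fun x => x).
Proof.
  intros He HLH; set (a := 1 / 2 + e) in *.
  assert (Ha : 1 / 2 < a <= 3 / 4) by (unfold a; lra).
  pose proof (gapped_increasing a ltac:(lra)) as Hn.
  (* B = 8 suffices: t = P^(1-a) with 1 - a >= 1/4 gives t^8 >= P^2 >= x. *)
  destruct (LH_gap _ e 8 Hn HLH ltac:(lra) ltac:(lra)) as [K HK].
  assert (Hln2 : 0 < ln 2) by (pose proof ln_lt_2; lra).
  assert (Hc : 0 < e * a * ln 2) by (repeat apply Rmult_lt_0_compat; lra).
  (* With P = 2^k this forces P^(ea) > 16 |K| + 4, by exp y >= 1 + y. *)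
  destruct (INR_archimed (e * a * ln 2) (16 * Rabs K + 4) Hc) as [k Hk].
  assert (Hk0 : k <> 0%nat).
  { intros ->; simpl in Hk; pose proof (Rabs_pos K); lra. }
  destruct k as [|m]; [easy|]; clear Hk0.
  (* [p s] is P^s for P = 2^(m+1). *)
  set (p := fun s => Rpower 2 (INR (S m) * s)).
  assert (pD : forall s r, p s * p r = p (s + r)).
  { intros s r; unfold p; rewrite <- Rpower_plus; f_equal; ring. }
  assert (p_pos : forall s, 0 < p s) by (intros s; apply exp_pos).
  assert (p_le : forall s r, s <= r -> p s <= p r).
  { intros s r Hsr; apply Rle_Rpower; [lra|].
    apply Rmult_le_compat_l; [apply pos_INR|exact Hsr]. }
  assert (p0 : p 0 = 1) by (unfold p; rewrite Rmult_0_r; apply Rpower_O; lra).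
  assert (p1 : p 1 = INR (2 ^ S m)).
  { unfold p; rewrite Rmult_1_r; apply Rpower_2_nat. }
  assert (p1_ge : 2 <= p 1).
  { unfold p; rewrite <- (Rpower_1 2) at 1 by lra; apply Rle_Rpower; [lra|].
    rewrite S_INR; pose proof (pos_INR m); lra. }
  assert (pow_pos : (0 < 2 ^ m)%nat) by (pose proof (Nat.pow_nonzero 2 m); lia).
  (* The last index of the dyadic block [m]; [S j] opens the next block, and the gap lies between
     their terms. *)
  set (j := (2 ^ S m - 1)%nat).
  assert (HSj : S j = (2 ^ S m)%nat) by (unfold j; simpl; lia).
  assert (Hj : INR j + 1 = p 1) by (rewrite <- S_INR, HSj; auto).
  destruct (skipped_bounds a (S j)) as [Su1 Su2].
  destruct (skipped_bounds a j) as [_ Sl2].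
  rewrite (Nat.log2_unique (S j) (S m)) in Su1, Su2 by (rewrite ?HSj; simpl; lia).
  rewrite (Nat.log2_unique j m) in Sl2 by (unfold j; simpl; lia).
  change (Rpower 2 (INR (S m) * a)) with (p a) in Su1, Su2.
  (* The ratio is 2^(-a) <= 2^(-1/2) < 3/4, so the gap keeps at least P^a / 4 - 1 integers. *)
  assert (Hprev : Rpower 2 (INR m * a) <= 3 / 4 * p a).
  { replace (INR m * a) with (- a + INR (S m) * a) by (rewrite S_INR; ring).
    rewrite Rpower_plus; apply Rmult_le_compat_r; [apply Rlt_le, p_pos|].
    apply Rle_trans with (Rpower 2 (- (1 / 2))); [apply Rle_Rpower; lra|].
    assert (Hsq : Rpower 2 (- (1 / 2)) * Rpower 2 (- (1 / 2)) = / 2).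
    { rewrite <- Rpower_plus; replace (- (1 / 2) + - (1 / 2)) with (- (1)) by lra.
      rewrite Rpower_Ropp, Rpower_1; lra. }
    pose proof (exp_pos (- (1 / 2) * ln 2)) as Hpos.
    change (exp _) with (Rpower 2 (- (1 / 2))) in Hpos; nra. }
  pose proof (INR_gapped a j) as Nj; pose proof (INR_gapped a (S j)) as NSj.
  rewrite Hj in Nj; rewrite S_INR, Hj in NSj.
  pose proof (pos_INR (skipped a j)) as Sl0.
  pose proof (le_INR _ _ (skipped_mono a j (S j) ltac:(lra) ltac:(lia))) as Smono.
  pose proof (p_le a 1 ltac:(lra)) as pa1.
  (* The last integer of the gap; x - n_j is the jump of [skipped]. *)
  set (x := INR (gapped a (S j)) - 1).
  (* This t balances the phase condition: t P^a = P <= n_j. *)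
  specialize (HK j (p (1 - a)) x).
  unfold rpow in HK; destruct (Rlt_dec 0 (p (1 - a))) as [_|Hbad];
    [|now contradict Hbad].
  assert (pX : forall s r, Rpower (p s) r = p (s * r)).
  { intros s r; unfold p; rewrite Rpower_mult; f_equal; ring. }
  rewrite !pX in HK.
  assert (Hx : INR (gapped a j) <= x < INR (gapped a (S j))) by (unfold x; lra).
  specialize (HK Hx (Rlt_le _ _ (p_pos _))).
  assert (Hphase : p (1 - a) * (x - INR (gapped a j)) <= INR (gapped a j)).
  { apply Rle_trans with (p (1 - a) * p a).
    - apply Rmult_le_compat_l; [apply Rlt_le, p_pos|unfold x; lra].
    - rewrite pD; replace (1 - a + a) with 1 by ring; lra. }
  specialize (HK Hphase).
  assert (Hx2 : x <= p 1 * p 1) by (unfold x; nra).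
  assert (HxB : x <= p ((1 - a) * 8)).
  { apply Rle_trans with (1 := Hx2); rewrite pD; apply p_le; lra. }
  specialize (HK HxB).
  assert (Hsqrt : sqrt x <= 2 * p (1 / 2)).
  { pose proof (p_pos (1 / 2)) as Hh.
    rewrite <- (sqrt_square (2 * p (1 / 2))) by lra.
    apply sqrt_le_1_alt.
    replace (2 * p (1 / 2) * (2 * p (1 / 2))) with (4 * (p (1 / 2) * p (1 / 2)))
      by ring.
    rewrite pD; replace (1 / 2 + 1 / 2) with 1 by field; unfold x; lra. }
  set (q := p (1 / 2 + (1 - a) * e)).
  assert (Hq : 1 <= q).
  { rewrite <- p0; apply p_le.
    pose proof (Rmult_le_pos (1 - a) e ltac:(lra) ltac:(lra)); lra. }
  assert (HKq : K * sqrt x * p ((1 - a) * e) <= 2 * Rabs K * q).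
  { unfold q; rewrite <- pD, <- Rmult_assoc.
    apply Rmult_le_compat_r; [apply Rlt_le, p_pos|].
    apply Rle_trans with (Rabs K * sqrt x).
    - apply Rmult_le_compat_r; [apply sqrt_pos|apply Rle_abs].
    - replace (2 * Rabs K * p (1 / 2)) with (Rabs K * (2 * p (1 / 2))) by ring.
      apply Rmult_le_compat_l; [apply Rabs_pos|exact Hsqrt]. }
  (* The exponents match because a = 1/2 + e = 1/2 + (1 - a) e + e a. *)
  assert (Hpa : p a = p (e * a) * q).
  { unfold q; rewrite pD; f_equal; unfold a; ring. }
  assert (Hbig : 16 * Rabs K + 4 < p (e * a)).
  { unfold p, Rpower; pose proof (exp_ineq1_le (INR (S m) * (e * a) * ln 2)); lra. }
  assert (Hgap : p a / 4 - 1 <= x - INR (gapped a j)) by (unfold x; lra).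
  (* From (P^a / 4 - 1) / 2 <= 2 |K| q, with the additive 4 absorbed by q >= 1. *)
  assert (Hfinal : p a <= (16 * Rabs K + 4) * q) by lra.
  rewrite Hpa in Hfinal; nra.
Qed.

Theorem theorem2p1 (eps : R) (heps : 0 < eps) :
  exists n : nat -> nat,
    increasing_pos n /\
    (exists K x0 : R, forall x : R, x0 <= x ->
       Rabs (counting n x - x) <= K * rpow x (1 / 2 + eps)) /\
    ~ LH n (fun x : R => x).
Proof.
  (* The cap 1/4 keeps the exponent 1/2 - e of t at least 1/4; the error term x^(1/2+e) is still
     within x^(1/2+eps). *)
  set (e := Rmin eps (1 / 4)).
  assert (He : 0 < e <= 1 / 4).
  { split; [apply Rmin_glb_lt; lra|apply Rmin_r]. }
  assert (Hle : e <= eps) by apply Rmin_l.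
  exists (gapped (1 / 2 + e)); split; [|split].
  - apply gapped_increasing; lra.
  - exists 2, (INR (gapped (1 / 2 + e) 0)); intros x Hx.
    apply Rle_trans with (2 * Rpower x (1 / 2 + e)).
    + apply counting_gapped; [lra|exact Hx].
    + rewrite INR_gapped in Hx; simpl in Hx.
      pose proof (pos_INR (skipped (1 / 2 + e) 0)).
      unfold rpow; destruct (Rlt_dec 0 x) as [_|Hx0]; [|lra].
      apply Rmult_le_compat_l; [lra|]; apply Rle_Rpower; lra.
  - apply not_LH_gapped, He.
Qed.
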